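(* Let $\mathcal{D}\subset\mathbb{R}^d$ be open and bounded, let $\Omega$ be an open set compactly contained in $\mathcal{D}$, and let $E=E(\Omega)$, $F=F(\Omega)$ be real Banach spaces with $F$ reflexive. Let $s_1>0$ and let $\mathcal{G}:[0,s_1]\times E\times F\to\mathbb{R}$ be of the form $$\mathcal{G}(s,\varphi,\psi)=\langle \mathcal{A}(s,\varphi),\psi\rangle_{F^*,F}+\mathcal{B}(s,\varphi),$$ with $\mathcal{A}\in\mathcal{C}^1([0,s_1]\times E,F^* )$ and $\mathcal{B}:[0,s_1]\times E\to\mathbb{R}$. Let $u\in E$ be such that $\mathcal{A}(0,u)=0$, and suppose that $\mathcal{B}$ is differentiable at $(0,u)$. Set $A(u):=\partial_\varphi\mathcal{A}(0,u)\in\mathcal{L}(E,F^* )$, $L(u):=\partial_s\mathcal{A}(0,u)\in F^*$ and $B(u):=\partial_\varphi\mathcal{B}(0,u)\in E^*$. Suppose that $A(u):E\to F^*$ is an isomorphism. Then there exist $s_0\in(0,s_1]$ and a unique $\mathcal{C}^1$ function $[0,s_0]\ni s\mapsto u^s\in E$ such that $u^0=u$ and $\mathcal{A}(s,u^s)=0$ for all $s\in[0,s_0]$. Moreover the derivative $\dot u\in E$ of $s\mapsto u^s$ at $s=0$ exists and is the unique solution in $E$ of $$A(u)\dot u=-L(u)\quad\text{in }F^*.$$ Furthermore, let $\theta\in\mathcal{C}^{0,1}_c(\mathcal{D},\mathbb{R}^d)$, let $\Omega_s:=T_s(\Omega)$ where $T_s$ is the flow of $\theta$, and suppose that the shape functional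 $J$ satisfies $$J(\Omega_s)=\mathcal{G}(s,u^s,\psi)\quad\text{for all }\psi\in F$$ (for $s\in[0,s_0]$). Then the shape derivative of $J$ at $\Omega$ in direction $\theta$ exists and is given by $$dJ(\Omega)(\theta)=\partial_s\mathcal{G}(0,u,p)=\langle L(u),p\rangle_{F^*,F}+\partial_s\mathcal{B}(0,u),$$ where the adjoint state $p\in F$ is the unique solution of $$A(u)^*p=-B(u)\quad\text{in }E^*,$$ and $A(u)^*:F\to E^*$ is the adjoint of $A(u):E\to F^*$.
   Context: $E^*=\mathcal{L}(E,\mathbb{R})$ is the dual of $E$ and $\mathcal{L}(E,F^* )$ is the space of continuous linear maps. An isomorphism is a bijective continuous linear map. Since $F$ is reflexive, the adjoint of $A\in\mathcal{L}(E,F^* )$ is the operator $A^*\in\mathcal{L}(F,E^* )$ defined by $\langle A^*g,h\rangle_{E^*,E}=\langle Ah,g\rangle_{F^*,F}$ for $g\in F$, $h\in E$. Derivatives with respect to $s$ at $s=0$ are one-sided. $\mathcal{C}^{0,1}_c(\mathcal{D},\mathbb{R}^d)$ is the space of Lipschitz vector fields with compact support in $\mathcal{D}$. For such $\theta$, the flow $T_s:\mathcal{D}\to\mathcal{D}$, $s\in[0,s_1]$, is defined by $T_s(x_0)=x(s)$, where $\dot x(s)=\theta(x(s))$, $x(0)=x_0$. A shape functional is a real-valued function $J$ defined on the set of open sets compactly contained in $\mathcal{D}$. The shape derivative (Eulerian semiderivative) of $J$ at $\Omega$ in direction $\theta$ is $dJ(\Omega)(\theta):=\lim_{s\searrow0}\frac{J(\Omega_s)-J(\Omega)}{s}$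 with $\Omega_s=T_s(\Omega)$. *)

(* Defs.v *)
From HB Require Import structures.
From mathcomp Require Import all_boot all_order all_algebra.
From mathcomp Require Import all_classical all_reals all_analysis.

Set Implicit Arguments.
Unset Strict Implicit.
Unset Printing Implicit Defensive.

Import Order.TTheory GRing.Theory Num.Theory.
Import numFieldNormedType.Exports.

Local Open Scope classical_set_scope.
Local Open Scope ring_scope.

Section ContinuousLinearMaps.
Context {R : realType} (V W : normedModType R).

Definition clinear : {pred V -> W} :=
  [pred f : V -> W | `[< linear f /\ continuous f >]].

Record clin := Clin { clin_val :> V -> W; _ : clin_val \in clinear }.

HB.instance Definition _ := [isSub for clin_val].
HB.instance Definition _ := [Choice of clin by <:].

Lemma clinearP (f : V -> W) : reflect (linear f /\ continuous f) (f \in clinear).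
Proof. exact: asboolP. Qed.

Lemma clinear_submod_closed : GRing.submod_closed clinear.
Proof.
split => [|a f g /clinearP[lf cf] /clinearP[lg cg]]; apply/clinearP.
  split; first by move=> a x y; rewrite scaler0 addr0.
  exact: (@cst_continuous _ _ 0).
split.
  move=> b x y; rewrite !fctE lf lg.
  by rewrite !scalerDr !scalerA addrACA [b * a]mulrC.
by move=> x; apply: (@cvgD _ _ _ (nbhs x)); [apply: (@cvgZl_tmp _ _ _ (nbhs x)); exact: cf|exact: cg].
Qed.

HB.instance Definition _ :=
  GRing.isSubmodClosed.Build _ _ clinear clinear_submod_closed.
HB.instance Definition _ := [SubChoice_isSubLmodule of clin by <:].

Lemma clin_linear (f : clin) : linear f.
Proof. by case: f => f /= /clinearP[]. Qed.

HB.instance Definition _ (f : clin) :=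
  GRing.isLinear.Build _ _ _ _ (clin_val f) (clin_linear f).

Lemma clin_continuous (f : clin) : continuous f.
Proof. by case: f => f /= /clinearP[]. Qed.

Lemma clinDE (f g : clin) x : (f + g) x = f x + g x. Proof. by []. Qed.
Lemma clinZE a (f : clin) x : (a *: f) x = a *: f x. Proof. by []. Qed.
Lemma clin0E x : (0 : clin) x = 0. Proof. by []. Qed.
Lemma clinP (f g : clin) : (forall x, f x = g x) -> f = g.
Proof. by move=> fg; apply/val_inj/funext. Qed.

Definition opnorm (f : clin) : R := sup [set `|f x| | x in [set x | `|x| <= 1]].

Lemma opnorm_has_sup (f : clin) :
  has_sup [set `|f x| | x in [set x | `|x| <= 1]].
Proof.
split; first by exists `|f 0|, 0 => //=; rewrite normr0.
have /linear_bounded_continuous/bounded_funP/(_ 1)[M fM] :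
  continuous (f : {linear V -> W}) by exact: clin_continuous.
by exists M => _ [x /= x1 <-]; exact: fM.
Qed.

Lemma opnorm_ge0 (f : clin) : 0 <= opnorm f.
Proof.
apply: (le_trans (normr_ge0 (f 0))); apply: ub_le_sup.
  by have [] := opnorm_has_sup f.
by exists 0 => //=; rewrite normr0.
Qed.

Lemma opnormP (f : clin) x : `|f x| <= opnorm f * `|x|.
Proof.
have [->|x0] := eqVneq x 0; first by rewrite linear0 !normr0 mulr0.
have nx : 0 < `|x| by rewrite normr_gt0.
rewrite -ler_pdivrMr// mulrC -[_^-1]ger0_norm ?invr_ge0// -normrZ.
rewrite -linearZ; apply: ub_le_sup; first by have [] := opnorm_has_sup f.
exists (`|x|^-1 *: x) => //=.
by rewrite normrZ normfV normr_id mulVf ?gt_eqF.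
Qed.

Lemma opnorm_le (f : clin) M :
  0 <= M -> (forall x, `|f x| <= M * `|x|) -> opnorm f <= M.
Proof.
move=> M0 fM; apply: ge_sup; first by have [] := opnorm_has_sup f.
move=> _ [x /= x1 <-]; apply: le_trans (fM x) _.
by rewrite -[leRHS]mulr1 ler_wpM2l.
Qed.

Let opnormD (f g : clin) : opnorm (f + g) <= opnorm f + opnorm g.
Proof.
apply: opnorm_le => [|x]; first by rewrite addr_ge0 ?opnorm_ge0.
rewrite clinDE mulrDl (le_trans (ler_normD _ _))//.
by rewrite lerD ?opnormP.
Qed.

Let opnormZ_le a (f : clin) : opnorm (a *: f) <= `|a| * opnorm f.
Proof.
apply: opnorm_le => [|x]; first by rewrite mulr_ge0 ?opnorm_ge0.
by rewrite clinZE normrZ -mulrA ler_wpM2l ?opnormP.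
Qed.

Let opnorm0_eq0 (f : clin) : opnorm f = 0 -> f = 0.
Proof.
move=> f0; apply: clinP => x; apply/eqP; rewrite -normr_le0.
by have := opnormP f x; rewrite f0 mul0r.
Qed.

Let opnormZ a (f : clin) : opnorm (a *: f) = `|a| * opnorm f.
Proof.
apply/eqP; rewrite eq_le opnormZ_le/=.
have [->|a0] := eqVneq a 0; first by rewrite normr0 mul0r opnorm_ge0.
rewrite -ler_pdivlMl ?normr_gt0// -normfV.
by rewrite (le_trans _ (opnormZ_le _ _))// scalerA mulVf// scale1r.
Qed.

HB.instance Definition _ := Lmodule_isNormed.Build R clin
  opnormD opnormZ opnorm0_eq0.

Lemma clin_normE (f : clin) : `|f| = opnorm f. Proof. by []. Qed.

Lemma bounded_clinear (f : V -> W) (M : R) :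
  linear f -> (forall x, `|f x| <= M * `|x|) -> f \in clinear.
Proof.
move=> lf fM; apply/clinearP; split => //.
pose g := HB.pack_for {linear V -> W} f (GRing.isLinear.Build _ _ _ _ f lf).
apply: (@bounded_linear_continuous _ _ _ g).
apply/bounded_funP => r; exists (`|M| * r) => x xr.
rewrite (le_trans (fM x))// (le_trans (ler_norm _))// normrM normr_id.
by rewrite ler_wpM2l.
Qed.

End ContinuousLinearMaps.

Section Derivatives.
Context {R : realType}.

(* The differential of the library, bundled with its continuity. *)
Definition cdiff (V W : normedModType R) (f : V -> W) (x : V) : clin V W :=
  insubd (0 : clin V W) ('d f x : V -> W).

Lemma cdiffE (V W : normedModType R) (f : V -> W) (x v : V) :
  differentiable f x -> cdiff f x v = 'd f x v.
Proof.
move=> df; rewrite /cdiff; congr (_ v).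
rewrite -[LHS]/(val _) val_insubd ifT//; apply/clinearP.
by split; [exact: linearP|exact: diff_continuous].
Qed.

(* Differentiability relative to [D]: at a boundary point of [D] only the
   increments that stay in [D] matter, which yields one-sided derivatives.
   The sets [D] used below are convex with nonempty interior, so that the
   differential is unique. *)
Definition is_diff_in (V W : normedModType R) (D : set V) (f : V -> W) (x : V)
    (l : clin V W) :=
  forall e : R, 0 < e ->
    \forall y \near within D (nbhs x), `|f y - f x - l (y - x)| <= e * `|y - x|.

Definition differentiable_in (V W : normedModType R) (D : set V) (f : V -> W)
    (x : V) :=
  exists l : clin V W, is_diff_in D f x l.

Definition C1_in (V W : normedModType R) (D : set V) (f : V -> W) :=
  exists2 df : V -> clin V W,
    (forall x, D x -> is_diff_in D f x (df x)) & {within D, continuous df}.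

Section Curves.
Context {V : normedModType R}.

Definition rquot (f : R -> V) (a h : R) : V := h^-1 *: (f (a + h) - f a).

Definition rderivable (f : R -> V) (a : R) := cvg (rquot f a h @[h --> 0^'+]).

Definition rderive (f : R -> V) (a : R) : V := lim (rquot f a h @[h --> 0^'+]).

Definition is_derive_in (D : set R) (f : R -> V) (a : R) (v : V) :=
  (t - a)^-1 *: (f t - f a) @[t --> within D a^'] --> v.

End Curves.
End Derivatives.

Section Duality.
Context {R : realType}.

Section Bidual.
Variable F : normedModType R.

Lemma bidual_clinear (x : F) : (fun f : clin F R => f x) \in @clinear R (clin F R) R.
Proof.
by apply: (@bounded_clinear _ _ _ _ `|x|) => // f; rewrite mulrC; exact: opnormP.
Qed.

Definition bidual (x : F) : clin (clin F R) R := Clin (bidual_clinear x).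

Definition reflexive_space := forall xi : clin (clin F R) R, exists x, bidual x = xi.

End Bidual.

Section Adjoint.
Variables (E F : normedModType R) (A : clin E (clin F R)).

Lemma adjoint_pt_clinear (g : F) : (fun h : E => A h g) \in @clinear R E R.
Proof.
apply: (@bounded_clinear _ _ _ _ (`|A| * `|g|)).
  by move=> a x y; rewrite linearP.
move=> h; rewrite mulrAC (le_trans (opnormP (A h) g))//.
by rewrite ler_wpM2r//; exact: (opnormP A h).
Qed.

Lemma adjoint_clinear :
  (fun g : F => Clin (adjoint_pt_clinear g)) \in @clinear R F (clin E R).
Proof.
apply: (@bounded_clinear _ _ _ _ `|A|).
  by move=> a x y; apply: clinP => h; rewrite clinDE clinZE /= linearP.
move=> g; apply: opnorm_le => [|h /=]; first by rewrite mulr_ge0.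
rewrite mulrAC (le_trans (opnormP (A h) g))//.
by rewrite ler_wpM2r//; exact: (opnormP A h).
Qed.

(* Reflexivity of [F] is what identifies this map [F -> E^*] with the Banach
   adjoint [F^** -> E^*]. *)
Definition adjoint : clin F (clin E R) := Clin adjoint_clinear.

End Adjoint.
End Duality.

(* R^d carries the sup norm of the library; openness, boundedness, compactness,
   Lipschitz continuity and differentiability do not depend on the choice of
   the norm. *)
Section Shapes.
Context {R : realType} {d : nat}.
Implicit Types (D Omega : set 'rV[R]_d) (theta : 'rV[R]_d -> 'rV[R]_d).

Definition compactly_contained Omega D :=
  compact (closure Omega) /\ closure Omega `<=` D.

(* Only the values of [theta] on [D] matter. *)
Definition lipschitz_field D theta :=
  [lipschitz theta x | x in D] /\
  compactly_contained [set x | D x /\ theta x != 0] D.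

Definition is_flow D (s1 : R) theta (T : R -> 'rV[R]_d -> 'rV[R]_d) :=
  forall x0, D x0 ->
    T 0 x0 = x0 /\
    forall s, 0 <= s <= s1 ->
      D (T s x0) /\
      is_derive_in `[0, s1] (fun t => T t x0) s (theta (T s x0)).

(* A shape functional is only relevant on open sets compactly contained in [D];
   it is extended arbitrarily to all sets. *)
Definition shape_quot (J : set 'rV[R]_d -> R) (T : R -> 'rV[R]_d -> 'rV[R]_d)
    Omega (s : R) : R :=
  (J (T s @` Omega) - J Omega) / s.

Definition shape_derivable J T Omega :=
  cvg (shape_quot J T Omega s @[s --> 0^'+]).

Definition shape_derive J T Omega : R :=
  lim (shape_quot J T Omega s @[s --> 0^'+]).

End Shapes.

Definition solution_path {R : realType} (E W : normedModType R)
    (A : R * E -> W) (u : E) (s0 : R) (us : R -> E) :=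
  [/\ C1_in `[0, s0] us, us 0 = u &
      forall s, 0 <= s <= s0 -> A (s, us s) = 0].

(* Main.v *)
(** The quasi-Newton map [phi - N (A (s, phi))], with [N] the inverse of
    [A(u)], contracts a ball around [u] uniformly in small [s]: on the convex
    strip [0, s1] x E a C^1 map is strictly differentiable, also at the boundary
    time [s = 0]. Its fixed points are the states [u^s]; differentiating
    [A (s, u^s) = 0] gives [u^s] its derivative, and a C^1 solution cannot leave
    the ball since solutions in the ball of radius [r] stay within [r / 2].
    Boundedness of [N] is the open mapping theorem in the complete space [F^*].

    Since [A (s, u^s) = 0], [J (Omega_s) = B (s, u^s)] has the derivative
    [d_s B + B(u) u'], and [B(u) u' = - (A(u) u') p = L(u) p] for the adjoint
    state [p]. Reflexivity of [F] yields [p]; its uniqueness needs that [F^*]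
    separates points, that is, the Hahn-Banach theorem. *)

Require Import Defs.
From HB Require Import structures.
From mathcomp Require Import all_boot all_order all_algebra.
From mathcomp Require Import all_classical all_reals all_analysis.
From mathcomp Require Import ring lra.

Set Implicit Arguments.
Unset Strict Implicit.
Unset Printing Implicit Defensive.

Import Order.TTheory GRing.Theory Num.Theory.
Import numFieldNormedType.Exports.

Local Open Scope classical_set_scope.
Local Open Scope ring_scope.

(** * Dual spaces and the open mapping theorem *)

Section ClinLinear.
Context {R : realType} (V W : normedModType R).
Implicit Types f : clin V W.

Lemma clinD f x y : f (x + y) = f x + f y. Proof. exact: linearD. Qed.
Lemma clinB f x y : f (x - y) = f x - f y. Proof. exact: linearB. Qed.
Lemma clinZ f a x : f (a *: x) = a *: f x. Proof. exact: linearZ. Qed.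
Lemma clin0 f : f 0 = 0. Proof. exact: linear0. Qed.
Lemma clinBE f g x : (f - g) x = f x - g x. Proof. by []. Qed.
Lemma clin_ler f x : `|f x| <= `|f| * `|x|. Proof. exact: opnormP. Qed.

End ClinLinear.

Section ClinComplete.
Context {R : realType} (V : normedModType R) (W : completeNormedModType R).

(** Completeness of [W] gives pointwise limits, which form a linear map. The Cauchy bounds, uniform
    on bounded sets, survive the pointwise limit: they bound the limit map and turn pointwise into
    operator norm convergence. *)
Lemma clin_complete (F : set_system (clin V W)) :
  ProperFilter F -> cauchy F -> cvg F.
Proof.
move=> FF cF.
have exF e : 0 < e -> exists f, F [set g : clin V W | `|f - g| < e].
  move=> e0; have /cauchyP/(_ e e0)[f] := cF.
  by rewrite -ball_normE => ?; exists f.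
have le_pt (f g : clin V W) x : `|f x - g x| <= `|f - g| * `|x|.
  exact: (opnormP (f - g)).
have cvx x : cvg (f x @[f --> F]).
  apply: cauchy_cvg; apply/cauchy_exP => e e0.
  have [|f Ff] := exF (e / (`|x| + 1)).
    by rewrite divr_gt0// ltr_wpDl.
  exists (f x) => /=; apply: filterS Ff => g /= fg.
  rewrite -ball_normE /=; apply: le_lt_trans (le_pt f g x) _.
  have [->|x0] := eqVneq x 0; first by rewrite normr0 mulr0.
  have nx : 0 < `|x| by rewrite normr_gt0.
  rewrite -ltr_pdivlMr// (lt_le_trans fg)// ler_pM2l//.
  by rewrite lef_pV2 ?posrE ?lerDl ?ltr_wpDl.
pose l x := lim (f x @[f --> F]).
have ll : linear l.
  move=> a x y.
  have lE : (fun f : clin V W => f (a *: x + y)) = (fun f => a *: f x + f y).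
    by apply/funext => f; rewrite linearP.
  have -> : l (a *: x + y) = lim ((fun f : clin V W => f (a *: x + y)) @ F) by [].
  rewrite lE; apply: cvg_lim => //; apply: cvgD; last exact: cvx.
  by apply: cvgZr; exact: cvx.
have lf (f : clin V W) e : F [set g : clin V W | `|f - g| < e] ->
    forall x, `|f x - l x| <= e * `|x|.
  move=> Ff x; apply/ler_addgt0Pr => h h0.
  have /cvgrPdist_le/(_ h h0) := cvx x; rewrite near_simpl => lg.
  near F => g.
  have fg : `|f - g| < e by near: g.
  rewrite -(subrKA (g x)) (le_trans (ler_normD _ _))// lerD//.
    by rewrite (le_trans (le_pt _ _ _))// ler_wpM2r// ltW.
  by rewrite distrC; near: g.
have lcl : l \in @clinear R V W.
  have [f /lf fl] := exF 1 ltr01.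
  apply: (@bounded_clinear _ _ _ _ (`|f| + 1)) => // x.
  rewrite -[l x](subrK (f x)) addrC mulrDl (le_trans (ler_normD _ _))//.
  by rewrite lerD ?opnormP// distrC.
apply/cvg_ex; exists (Clin lcl); apply/cvgrPdist_le => e e0.
have [|f Ff] := exF (e / 2); first by rewrite divr_gt0.
apply: filterS (Ff) => g /= /ltW fg.
rewrite -(subrKA f) (splitr e) (le_trans (ler_normD _ _))// lerD//.
apply: opnorm_le => [|x]; first by rewrite divr_ge0// ltW.
by rewrite distrC; exact: lf.
Unshelve. all: by end_near. Qed.

HB.instance Definition _ := Uniform_isComplete.Build (clin V W) clin_complete.

End ClinComplete.

Section HahnBanach.
Context {R : realType} (V : normedModType R).

(** Partial functionals are encoded as linear relations, so that extension is inclusion and chains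
    have their union as upper bound. *)
Let dominated_graph (G : set (V * R)) :=
  (forall a z w, G z -> G w -> G (a *: z + w)) /\
  (forall z, G z -> z.2 <= `|z.1|).

(* A linear relation dominated by the norm is the graph of a functional. *)
Let dominated_graph_fun G : dominated_graph G ->
  forall x r s, G (x, r) -> G (x, s) -> r = s.
Proof.
move=> [lG dG].
suff le x r s : G (x, r) -> G (x, s) -> s <= r.
  by move=> x r s Gr Gs; apply/eqP; rewrite eq_le !(le x).
move=> Gr Gs; have := dG _ (lG (-1) _ _ Gr Gs).
by rewrite /= !scaleN1r addNr normr0 addrC subr_le0.
Qed.

(** The value [c] at [x] has to lie above all [z.2 - |z.1 - x|] and below all [|w.1 + x| - w.2]. By
    domination and the triangle inequality each lower bound is at most each upper bound, so the
    supremum of the lower ones will do. If [x] is already in the domain, these bounds force its old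
    value. *)
Let dominated_graph_extend G x : dominated_graph G -> G !=set0 ->
  exists H, [/\ dominated_graph H, G `<=` H & exists r, H (x, r)].
Proof.
move=> dgG [z0 Gz0]; have [lG dG] := dgG.
have G0 : G (0, 0).
  have := lG (-1) _ _ Gz0 Gz0.
  by rewrite (_ : _ + _ = (0, 0))//; congr (_, _); rewrite /= scaleN1r addNr.
have GZ a z : G z -> G (a *: z).
  move=> Gz; have := lG a _ _ Gz G0; rewrite (_ : _ + _ = a *: z)//.
  by congr (_, _); rewrite /= addr0.
pose S := [set z.2 - `|z.1 - x| | z in G].
have Sub z w : G z -> G w -> z.2 - `|z.1 - x| <= `|w.1 + x| - w.2.
  move=> Gz Gw; rewrite lerBlDr addrAC lerBrDr.
  have := dG _ (lG 1 _ _ Gz Gw); rewrite /= !scale1r => /le_trans; apply.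
  rewrite (le_trans _ (ler_normD _ _))//.
  by rewrite (_ : w.1 + x + (z.1 - x) = z.1 + w.1)// addrCA addrK.
have S0 : S !=set0 by exists (z0.2 - `|z0.1 - x|), z0.
pose c := sup S.
have c_ge z : G z -> z.2 - c <= `|z.1 - x|.
  move=> Gz; rewrite lerBlDl -lerBlDr; apply: ub_le_sup; last by exists z.
  by exists (`|z0.1 + x| - z0.2) => _ [w Gw <-]; exact: Sub.
have c_le z : G z -> z.2 + c <= `|z.1 + x|.
  move=> Gz; rewrite -lerBrDl; apply: ge_sup => // _ [w Gw <-]; exact: Sub.
exists [set z | exists t, G (z.1 - t *: x, z.2 - t * c)]; split.
- split=> [a z w [t Gt] [s Gs]|z [t Gt]].
    exists (a * t + s); have := lG a _ _ Gt Gs.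
    rewrite /= (_ : _ + _ = ((a *: z + w).1 - (a * t + s) *: x,
       (a *: z + w).2 - (a * t + s) * c))//.
    congr (_, _) => /=.
      by rewrite scalerBr scalerDl scalerA opprD addrACA.
    by rewrite -![_ *: _]/(_ * _); ring.
  (* Scaling by the inverse of [|t|] reduces domination to [c_ge] for negative [t] and to [c_le] for
     positive [t]. *)
  have [t0|t0|t0] := ltgtP t 0.
  - have := c_ge _ (GZ (- t)^-1 _ Gt).
    have nt : 0 < - t by rewrite oppr_gt0.
    have <- : `|(- t)^-1 *: z.1| =
        `|((- t)^-1 *: (z.1 - t *: x, z.2 - t * c)).1 - x|.
      rewrite /= scalerBr scalerA invrN mulNr mulVf ?lt_eqF// scaleN1r opprK.
      by rewrite addrK.
    rewrite normrZ ger0_norm ?invr_ge0 ?(ltW nt)// => /=.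
    rewrite -[_ *: _]/(_ * _) mulrBr (mulrA _ t) invrN (mulNr _ t).
    rewrite mulVf ?lt_eqF// mulN1r opprK addrK -invrN.
    by rewrite ler_pM2l// invr_gt0.
  - have := c_le _ (GZ t^-1 _ Gt).
    have <- : `|t^-1 *: z.1| = `|(t^-1 *: (z.1 - t *: x, z.2 - t * c)).1 + x|.
      by rewrite /= scalerBr scalerA mulVf ?gt_eqF// scale1r subrK.
    rewrite normrZ ger0_norm ?invr_ge0 ?(ltW t0)// => /=.
    rewrite -[_ *: _]/(_ * _) mulrBr (mulrA _ t) mulVf ?gt_eqF// mul1r subrK.
    by rewrite ler_pM2l// invr_gt0.
  - by move: Gt; rewrite t0 scale0r mul0r !subr0; exact: dG.
- by move=> [y r] Gy; exists 0; rewrite scale0r mul0r !subr0.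
- by exists c, 1; rewrite /= scale1r mul1r !subrr.
Qed.

(** Hahn-Banach: Zorn's lemma yields a maximal dominated graph above the line through [(x, |x|)],
    and one-dimensional extension shows that its domain is the whole space. *)
Lemma norming_functional (x : V) : exists f : clin V R, f x = `|x|.
Proof.
pose base := [set (t *: x, t * `|x|) | t in [set: R]].
(* [P] holds of [set0], as the union of the empty chain demands. *)
pose P G := dominated_graph G /\ (forall z, G z -> base `<=` G).
have [M [[dgM bM] maxM]] : exists M, P M /\ forall H, M `<` H -> ~ P H.
  apply: Zorn_bigcup => C CP tC; split; last first.
    move=> z [G CG Gz]; have [_ /(_ _ Gz) bG] := CP _ CG.
    by apply: subset_trans bG _; exact: bigcup_sup.
  split=> [a z w [G CG Gz] [H CH Hw]|z [G CG Gz]]; last first.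
    by have [[_ dG] _] := CP _ CG; exact: dG.
  have [GH|HG] := tC _ _ CG CH.
    by exists H => //; have [[lH _] _] := CP _ CH; apply: lH => //; exact: GH.
  by exists G => //; have [[lG _] _] := CP _ CG; apply: lG => //; exact: HG.
have dgbase : dominated_graph base.
  split=> [a _ _ [t _ <-] [s _ <-]|_ [t _ <-]] /=.
    by exists (a * t + s) => //; rewrite scalerDl mulrDl -scalerA -mulrA.
  by rewrite normrZ ler_wpM2r// ler_norm.
have base1 : base (x, `|x|) by exists 1; rewrite ?scale1r ?mul1r.
(* The empty graph satisfies [P] but is not maximal, since [base] lies strictly above it. *)
have M0 : M !=set0.
  apply/set0P/eqP => M0; apply: (maxM base); last first.
    by split=> // z _; exact: subset_refl.
  by rewrite M0; split; [exact: sub0set|move=> /(_ _ base1)].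
have Mx : M (x, `|x|) by have [z /bM] := M0; exact.
have totM y : exists r, M (y, r).
  have [H [dgH MH [r Hr]]] := dominated_graph_extend y dgM M0.
  exists r; apply: contrapT => Mr; apply: (maxM H).
    by split=> // /(_ (y, r) Hr).
  by split=> // z _; have [w Mw] := M0; exact: subset_trans (bM _ Mw) MH.
have [f fM] := choice totM.
have [lM dM] := dgM.
have lf : linear f.
  move=> a y z; apply: (dominated_graph_fun dgM) (fM _) _.
  exact: (lM a _ _ (fM y) (fM z)).
have fcl : f \in @clinear R V R.
  apply: (@bounded_clinear _ _ _ _ 1) => // y; rewrite mul1r.
  (* The lower bound on [f y] is domination at [- y]. *)
  rewrite ler_norml lerNl (dM _ (fM y)) andbT -normrN.
  have := lM (-1) _ _ (fM y) (fM 0); rewrite /= scaleN1r => /dM /=.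
  have -> : f 0 = 0 by apply: (dominated_graph_fun dgM) (fM 0) _;
    have := lM (-1) _ _ Mx Mx; rewrite (_ : _ + _ = (0, 0))//;
    congr (_, _); rewrite /= scaleN1r addNr.
  by rewrite !addr0.
by exists (Clin fcl); apply: (dominated_graph_fun dgM) (fM x) Mx.
Qed.

Lemma bidual_inj : injective (@bidual R V).
Proof.
move=> x y xy; apply/eqP; rewrite -subr_eq0 -normr_eq0.
have [f <-] := norming_functional (x - y).
rewrite linearB subr_eq0; apply/eqP.
exact: (congr1 (fun xi : clin (clin V R) R => xi f) xy).
Qed.

End HahnBanach.

Section ContractionFixedPoint.
Context {R : realType}.

Lemma contraction_fixed_point (X : completeNormedModType R) (U : set X)
    (f : X -> X) (k : R) :
  0 <= k < 1 -> closed U -> U !=set0 -> (forall x, U x -> U (f x)) ->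
  (forall x y, U x -> U y -> `|f x - f y| <= k * `|x - y|) ->
  exists2 x, U x & f x = x.
Proof.
move=> /andP[k0 k1] cU U0 Uf fk.
pose g := HB.pack_for {fun U >-> U} f (isFun.Build _ _ U U f Uf).
have [|x Ux fx] := @banach_fixed_point _ _ U g _ cU U0; last by exists x.
by exists (NngNum k0); split=> //= -[x y] [/= Ux Uy]; exact: fk.
Qed.

End ContractionFixedPoint.

Section OpenMapping.
Context {R : realType} (E W : completeNormedModType R) (T : clin E W).
Hypothesis surjT : forall w, exists x, T x = w.

Let Im n := T @` [set x | `|x| <= n%:R].

(** Baire: were all the open complements of the closures dense, they would have a common point, yet
    every [w = T x] lies in [Im n] once [n] exceeds [|x|]. *)
Let image_closure_interior :
  exists n w (r : R), 0 < r /\ ball w r `<=` closure (Im n).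
Proof.
pose O n := ~` closure (Im n).
have [n dO] : exists n, ~ dense (O n).
  apply: contrapT => /forallNP dO.
  have /Baire/(_ [set: W]) : forall n, open (O n) /\ dense (O n).
    move=> n; split; last exact: contrapT.
    exact/closed_openC/closed_closure.
  case; [by exists 0|exact: openT|move=> w [_ Ow]].
  have [x Tx] := surjT w.
  apply: (Ow (Num.truncn `|x|).+1) => //; apply: subset_closure.
  by exists x => //=; exact/ltW/Num.Theory.truncnS_gt.
have [U [[w [oU Uw]] UO]] := denseNE dO.
have /nbhs_ballP[r r0 wU] : nbhs w U by exact: open_nbhs_nbhs.
exists n, w, r; split => // v /wU Uv; apply: contrapT => Ov.
by have : (U `&` O n) v by []; rewrite UO.
Qed.

(** Subtracting approximate preimages of [w0 + w] and [w0] moves the ball from [w0] to the origin;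
    homogeneity then reaches every [w]. *)
Let approx_solution : exists2 K : R, 0 < K &
  forall w, exists x, `|x| <= K * `|w| /\ `|w - T x| <= `|w| / 2.
Proof.
have [n [w0 [r [r0 wr]]]] := image_closure_interior.
have near_image v : ball w0 r v -> forall e : R, 0 < e ->
    exists2 x, `|x| <= n%:R & `|v - T x| < e.
  move=> /wr cv e e0; have [_ [[x xn <-]]] := cv _ (nbhsx_ballx _ _ e0).
  by rewrite -ball_normE /= => vx; exists x.
have near0 (w : W) : `|w| < r -> forall e : R, 0 < e ->
    exists2 x, `|x| <= n%:R *+ 2 & `|w - T x| < e.
  move=> wlt e e0; have e2 : 0 < e / 2 by rewrite divr_gt0.
  have [|x xn wx] := near_image (w0 + w) _ _ e2.
    by rewrite -ball_normE /= opprD addNKr normrN.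
  have [|y yn wy] := near_image w0 _ _ e2; first exact: ballxx.
  exists (x - y).
    by rewrite mulr2n (le_trans (ler_normB _ _))// lerD.
  rewrite linearB (_ : w - _ = (w0 + w - T x) - (w0 - T y)); last first.
    by rewrite !opprD !opprK addrACA (addrAC w0) subrr add0r.
  by rewrite (splitr e) (le_lt_trans (ler_normB _ _))// ltrD.
(* The summand [1] keeps the constant positive when [n = 0]. *)
exists (n%:R *+ 2 / (r / 2) + 1).
  rewrite ltr_wpDl//; apply: mulr_ge0; first by rewrite mulrn_wge0.
  by rewrite invr_ge0 ltW// divr_gt0.
move=> w; have [->|w_neq0] := eqVneq w 0.
  by exists 0; rewrite linear0 subr0 !normr0 mulr0 mul0r.
have w_gt0 : 0 < `|w| by rewrite normr_gt0.
(* [a *: w] has norm [r / 2], inside the ball; an error [r / 4] there becomes [|w| / 2] after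
   scaling back. *)
pose a := r / 2 / `|w|; have a0 : 0 < a by rewrite !divr_gt0.
have aw : `|a *: w| < r.
  by rewrite normrZ gtr0_norm// divfK ?gt_eqF// ltr_pdivrMr// ltr_pMr ?ltr1n.
have r4 : 0 < r / 4 by rewrite divr_gt0.
have [x xn wx] := near0 _ aw _ r4.
have aV : a^-1 = `|w| / (r / 2) by rewrite /a invf_div.
exists (a^-1 *: x); split.
  rewrite normrZ gtr0_norm ?invr_gt0// mulrDl mul1r ler_wpDr//.
  rewrite aV mulrC -[leRHS]mulrA (mulrC _ `|w|) ler_wpM2r//.
  by rewrite divr_ge0 ?ltW// divr_gt0.
rewrite linearZ -[w in w - _](scalerK (lt0r_neq0 a0)) -scalerBr.
rewrite normrZ gtr0_norm ?invr_gt0//.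
rewrite (le_trans (ler_wpM2l _ (ltW wx))) ?invr_ge0 ?(ltW a0)//.
by rewrite aV le_eqVlt; apply/orP; left; apply/eqP; field; rewrite gt_eqF.
Qed.

(** The corrections are dominated by a geometric series of ratio 1/2, so they sum to an exact
    solution, at the cost of a factor 2 in the constant. *)
Lemma open_mapping : exists2 C : R, 0 < C &
  forall w, exists2 x, T x = w & `|x| <= C * `|w|.
Proof.
have [K K0 appr] := approx_solution.
have [g gP] := choice appr.
exists (K * 2) => [|w]; first by rewrite mulr_gt0.
(* Correct the residual repeatedly; it is halved at each step. *)
pose res k := iter k (fun v => v - T (g v)) w.
have res_le k : `|res k| <= `|w| * 2^-1 ^+ k.
  elim: k => [|k IH]; first by rewrite expr0 mulr1.
  have [_ /le_trans] := gP (res k); apply.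
  by rewrite exprSr mulrA ler_wpM2r.
pose x := limn (series (g \o res)).
have gres_le k : `|g (res k)| <= geometric (K * `|w|) 2^-1 k.
  have [/le_trans + _] := gP (res k); apply.
  by rewrite /= -mulrA ler_wpM2l// ltW.
have half1 : `|2^-1 : R| < 1 by rewrite ger0_norm//; lra.
have cn : cvgn [normed series (g \o res)].
  apply: (@series_le_cvg _ _ (geometric (K * `|w|) 2^-1)) => //.
  - by move=> k; exact: normr_ge0.
  - by move=> k; exact: le_trans (normr_ge0 _) (gres_le k).
  - exact: is_cvg_geometric_series.
have cx : series (g \o res) @ \oo --> x := normed_cvg cn.
exists x.
  (* The images of the partial sums telescope, and the residuals tend to 0. *)
  have TE : T \o series (g \o res) = fun n => w - res n.
    apply/funext; elim => [|n IH].
      by rewrite /= /series/= big_geq// linear0 subrr.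
    move: IH; rewrite /= /series/= big_nat_recr//= clinD => ->.
    by rewrite opprB addrCA addrC.
  have Tx : (T \o series (g \o res)) @ \oo --> T x.
    by apply: cvg_comp cx _; exact: clin_continuous.
  have : (T \o series (g \o res)) @ \oo --> w.
    rewrite TE -[w in _ --> w]subr0; apply: cvgB; first exact: cvg_cst.
    apply/norm_cvg0P.
    apply: (@squeeze_cvgr _ _ _ _ (cst 0) (geometric `|w| 2^-1)).
    + by apply: nearW => n; rewrite normr_ge0 res_le.
    + exact: cvg_cst.
    + exact: cvg_geometric.
  move=> /(cvg_lim (@norm_hausdorff _ _)) <-.
  by rewrite (cvg_lim (@norm_hausdorff _ _) Tx).
rewrite (le_trans (lim_series_norm cn))//.
have cg := @cvg_geometric_series R (K * `|w|) 2^-1 half1.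
have -> : K * 2 * `|w| = limn (series (geometric (K * `|w|) 2^-1)).
  rewrite (cvg_lim (@norm_hausdorff _ _) cg).
  have -> : 1 - 2^-1 = 2^-1 :> R by rewrite {1}(splitr 1) mul1r addrK.
  by rewrite invrK mulrAC.
apply: lim_series_le => //; exact: cvgP cg.
Qed.

End OpenMapping.

(** * Calculus relative to a convex domain *)

Section RelativeDifferential.
Context {R : realType} (V W : normedModType R).
Implicit Types (D : set V) (l : clin V W).

Lemma within_normP D (x : V) (P : set V) :
  (\forall y \near within D (nbhs x), P y) <->
  exists2 d : R, 0 < d & forall y, D y -> `|y - x| < d -> P y.
Proof.
split=> [/nbhs_normP[d d0 dP]|[d d0 dP]].
  by exists d => // y Dy yx; apply: dP => //=; rewrite distrC.
by apply/nbhs_normP; exists d => //= y /= yx Dy; apply: dP => //; rewrite distrC.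
Qed.

Lemma is_diff_inP D f (x : V) l : is_diff_in D f x l <->
  forall e : R, 0 < e -> exists2 d : R, 0 < d & forall y, D y -> `|y - x| < d ->
    `|f y - f x - l (y - x)| <= e * `|y - x|.
Proof. by split=> h e /h /within_normP. Qed.

Lemma within_continuousP D (f : V -> W) : {within D, continuous f} <->
  forall x, D x -> forall e : R, 0 < e ->
    exists2 d : R, 0 < d & forall y, D y -> `|y - x| < d -> `|f y - f x| <= e.
Proof.
split=> [/subspace_continuousP cf x Dx e e0|cf].
  have /cvgrPdist_le/(_ e e0)/within_normP[d d0 dP] := cf x Dx.
  by exists d => // y Dy yx; rewrite distrC; exact: dP.
apply/subspace_continuousP => x Dx; apply/cvgrPdist_le => e e0.
have [d d0 dP] := cf x Dx e e0.
by apply/within_normP; exists d => // y Dy yx; rewrite distrC; exact: dP.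
Qed.

End RelativeDifferential.

Section MeanValue.
Context {R : realType}.

(** Continuous induction: the set of times where the bound from 0 holds contains its supremum [s],
    and the local estimate at [s] carries it further unless [s = 1]. *)
Lemma locally_lipschitz_01 (W : normedModType R) (f : R -> W) (M : R) :
  (forall t, 0 <= t <= 1 -> exists2 d, 0 < d & forall t', 0 <= t' <= 1 ->
    `|t' - t| < d -> `|f t' - f t| <= M * `|t' - t|) ->
  `|f 1 - f 0| <= M.
Proof.
move=> fM; pose S := [set t | 0 <= t <= 1 /\ `|f t - f 0| <= M * t].
have S0 : S 0 by rewrite /S /= lexx ler01 subrr normr0 mulr0.
have S1 : ubound S 1 by move=> t [/andP[]].
have hS : has_sup S by split; [exists 0|exists 1].
pose s := sup S.
have s0 : 0 <= s by apply: ub_le_sup => //; exists 1.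
have s1 : s <= 1 by apply: ge_sup => //; exists 0.
have s01 : 0 <= s <= 1 by rewrite s0.
have [d d0 dP] := fM s s01.
have step t t' : 0 <= t <= t' -> `|f t - f 0| <= M * t ->
    `|f t' - f t| <= M * `|t' - t| -> `|f t' - f 0| <= M * t'.
  move=> /andP[t0 tt'] ft ftt'.
  rewrite -(subrKA (f t)) (le_trans (ler_normD _ _))//.
  rewrite (le_trans (lerD ftt' ft))// ger0_norm ?subr_ge0//.
  by rewrite -mulrDr subrK.
have Ss : S s.
  split=> //; have [t [/andP[t0 t1] ft] st] := sup_adherent d0 hS.
  have ts : t <= s by apply: ub_le_sup; [exists 1|split=> //; rewrite t0].
  apply: (step t) => //; first by rewrite t0.
  rewrite distrC [`|s - t|]distrC; apply: dP; first by rewrite t0.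
  by rewrite distrC ger0_norm ?subr_ge0// ltrBlDr addrC -ltrBlDr.
have [s_lt1|] := ltP s 1; last first.
  by move=> s1'; have [_] := Ss; rewrite (_ : s = 1) ?mulr1//; apply/le_anti/andP.
(* A time beyond [s] that stays in [0, 1] and within the local radius [d]. *)
pose t := Num.min 1 (s + d / 2).
have st : s < t by rewrite lt_min s_lt1 ltrDl divr_gt0.
suff St : S t.
  have : t <= s by apply: ub_le_sup St; exists 1.
  by rewrite leNgt st.
have t01 : 0 <= t <= 1 by rewrite (le_trans s0 (ltW st)) ge_min lexx.
split=> //; apply: (step s); [by rewrite s0 ltW|by case: Ss|].
apply: dP => //; rewrite ger0_norm ?subr_ge0 ?ltW//.
rewrite ltrBlDl gt_min; apply/orP; right.
by rewrite ltrD2l ltr_pdivrMr// ltr_pMr// ltr1n.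
Qed.

Context {V W : normedModType R}.

(** Along the segment, [f] minus its linear part [l] is locally Lipschitz with constant
    [(e + h) * |b - a|], where an arbitrary [h > 0] absorbs the differentiability remainder. *)
Lemma mean_value (D : set V) (f : V -> W) (df : V -> clin V W) (l : clin V W)
    (a b : V) (e : R) :
  (forall t : R, 0 <= t <= 1 -> let z := a + t *: (b - a) in
    [/\ D z, is_diff_in D f z (df z) & `|df z - l| <= e]) ->
  `|f b - f a - l (b - a)| <= e * `|b - a|.
Proof.
move=> fP; have [->|ab] := eqVneq b a.
  by rewrite !subrr clin0 subrr !normr0 mulr0.
have nab : 0 < `|b - a| by rewrite normr_gt0 subr_eq0.
rewrite -ler_pdivrMr//; apply/ler_addgt0Pr => h h0; rewrite ler_pdivrMr//.
pose z t := a + t *: (b - a).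
have zB t t' : z t' - z t = (t' - t) *: (b - a).
  by rewrite /z opprD addrACA subrr add0r scalerBl.
have nzB t t' : `|z t' - z t| = `|t' - t| * `|b - a| by rewrite zB normrZ.
pose g t := f (z t) - t *: l (b - a).
have -> : f b - f a - l (b - a) = g 1 - g 0.
  rewrite /g /z !scale1r !scale0r addr0 subr0 (addrC a) subrK.
  by rewrite addrAC.
apply: locally_lipschitz_01 => t /[dup] t01 /fP[Dz dfz le].
have [d d0 dP] := (is_diff_inP D f (z t) (df (z t))).1 dfz h h0.
exists (d / `|b - a|) => [|t' /fP[Dz' _ _] tt']; first by rewrite divr_gt0.
have -> : g t' - g t = (f (z t') - f (z t) - df (z t) (z t' - z t)) +
    (df (z t) - l) (z t' - z t).
  rewrite clinBE addrA subrK /g opprB zB clinZ scalerBl opprB.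
  by rewrite addrACA [RHS]addrACA; congr (_ + _); rewrite addrC.
rewrite -mulrA [_ * `|t' - t|]mulrC -nzB mulrDl [leRHS]addrC.
rewrite (le_trans (ler_normD _ _))// lerD//; last first.
  by rewrite (le_trans (clin_ler _ _))// ler_wpM2r.
by apply: dP => //; rewrite nzB -ltr_pdivlMr.
Qed.

Definition convex_in (D : set V) := forall a b, D a -> D b ->
  forall t : R, 0 <= t <= 1 -> D (a + t *: (b - a)).

(** Segments between points of [D] near [x0] stay in [D] and in the ball, where [df] is [e]-close to
    [df x0]; the mean value estimate applies with [l = df x0]. *)
Lemma strict_differentiability (D : set V) (f : V -> W) (df : V -> clin V W)
    (x0 : V) :
  convex_in D -> (forall x, D x -> is_diff_in D f x (df x)) ->
  {within D, continuous df} -> D x0 -> forall e : R, 0 < e ->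
  exists2 d : R, 0 < d &
    (forall x, D x -> `|x - x0| < d -> `|df x - df x0| <= e) /\
    (forall x y, D x -> D y -> `|x - x0| < d -> `|y - x0| < d ->
      `|f y - f x - df x0 (y - x)| <= e * `|y - x|).
Proof.
move=> cD fD /within_continuousP cdf Dx0 e e0.
have [d d0 dP] := cdf x0 Dx0 e e0.
exists d => //; split=> // x y Dx Dy xd yd.
apply: (@mean_value D f df) => t /andP[t0 t1] z.
have Dz : D z by apply: cD => //; rewrite t0.
split=> //; [exact: fD|apply: dP => //].
have -> : z - x0 = (1 - t) *: (x - x0) + t *: (y - x0).
  rewrite /z [in RHS]scalerBl scale1r -[RHS]addrA [- _ + _]addrC -scalerBr.
  by rewrite opprB subrKA addrAC.
rewrite (le_lt_trans (ler_normD _ _))// !normrZ !ger0_norm ?subr_ge0//.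
rewrite (_ : d = (1 - t) * d + t * d); last by ring.
have [t'|t'] := ltP 0 t.
  by rewrite ler_ltD// ?ltr_pM2l// ler_wpM2l ?subr_ge0// ltW.
have -> : t = 0 by apply/le_anti; rewrite t'.
by rewrite !subr0 !mul0r !mul1r !addr0.
Qed.

End MeanValue.

Section PartialDifferential.
Context {R : realType} (E W : normedModType R).
Implicit Types l : clin (R * E)%type W.

Lemma partial2_clinear l : (fun h : E => l (0, h)) \in @clinear R E W.
Proof.
apply: (@bounded_clinear _ _ _ _ `|l|) => [a x y|x].
  by rewrite -clinZ -clinD; congr (l (_, _)); rewrite /= scaler0 addr0.
by rewrite (le_trans (clin_ler _ _))// prod_normE /= normr0 max_r.
Qed.

Definition partial2 l : clin E W := Clin (partial2_clinear l).

Lemma partial2B l m : partial2 l - partial2 m = partial2 (l - m).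
Proof. exact: clinP. Qed.

Lemma partial2_le l : `|partial2 l| <= `|l|.
Proof.
apply: opnorm_le => //= h.
by rewrite (le_trans (clin_ler _ _))// prod_normE /= normr0 max_r.
Qed.

Lemma partialE l t h : l (t, h) = t *: l (1, 0) + partial2 l h.
Proof.
rewrite -clinZ -[partial2 l h]/(l (0, h)) -clinD; congr (l (_, _)) => /=.
  by rewrite addr0 [t *: _]mulr1.
by rewrite scaler0 add0r.
Qed.

Lemma line_clinear (v : E) : (fun t : R => t *: v) \in @clinear R R E.
Proof.
apply: (@bounded_clinear _ _ _ _ `|v|) => [a x y|x].
  by rewrite scalerDl scalerA.
by rewrite normrZ mulrC.
Qed.

(** Turns the derivative [v] of a curve into a differential, the form that [C1_in] requires. *)
Definition line (v : E) : clin R E := Clin (line_clinear v).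

Lemma lineB_le v w : `|line v - line w| <= `|v - w|.
Proof.
by apply: opnorm_le => // t; rewrite clinBE /= -scalerBr normrZ mulrC.
Qed.

End PartialDifferential.

(** * Implicit function theorem up to the boundary *)

Section QuasiNewton.
Context {R : realType} (E : completeNormedModType R) (W : normedModType R).
Variables (M0 : clin E W) (N : W -> E) (C : R).
Hypotheses (C0 : 0 < C) (NK : forall w, M0 (N w) = w).
Hypothesis M0_ge : forall h, `|h| <= C * `|M0 h|.

(** Chosen so that [C * e = 1/2], the contraction factor. *)
Let e : R := (2 * C)^-1.

Let N_eq0 w : (N w == 0) = (w == 0).
Proof.
apply/eqP/eqP => [Nw|->]; first by rewrite -[w]NK Nw clin0.
by apply/eqP; rewrite -normr_le0 (le_trans (M0_ge _))// NK normr0 mulr0.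
Qed.

(** [M0] sends the difference of the two images to minus the Taylor remainder of [g], and inverting
    [M0] costs a factor [C]. *)
Lemma quasi_newton_contraction (g : E -> W) x y :
  `|g y - g x - M0 (y - x)| <= e * `|y - x| ->
  `|(y - N (g y)) - (x - N (g x))| <= 2^-1 * `|y - x|.
Proof.
move=> gxy; rewrite (le_trans (M0_ge _))//.
have -> : M0 (y - N (g y) - (x - N (g x))) = - (g y - g x - M0 (y - x)).
  rewrite !clinB !NK !opprB addrACA [RHS]addrACA; congr (_ + _).
  by rewrite addrC.
rewrite normrN (le_trans (ler_wpM2l (ltW C0) gxy))// mulrA ler_wpM2r//.
by rewrite /e invfM mulrCA mulfV ?mulr1// gt_eqF.
Qed.

(** The ball is preserved because [r / 2 + r / 4 <= r], and zeros of [g] are exactly the fixed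
    points. A fixed point satisfies [|x - u| <= |x - u| / 2 + r / 4], hence the radius [r / 2],
    which later confines competing solution paths. *)
Lemma quasi_newton_zero (g : E -> W) (u : E) (r : R) : 0 <= r ->
  (forall x y, `|x - u| <= r -> `|y - u| <= r ->
    `|g y - g x - M0 (y - x)| <= e * `|y - x|) ->
  C * `|g u| <= r / 4 ->
  exists x, [/\ g x = 0, `|x - u| <= r / 2 &
    forall y, `|y - u| <= r -> g y = 0 -> y = x].
Proof.
move=> r0 gP gu; pose f x := x - N (g x).
have fu : `|f u - u| <= r / 4.
  by rewrite /f addrAC subrr add0r normrN (le_trans (M0_ge _))// NK.
have fP x y : `|x - u| <= r -> `|y - u| <= r -> `|f y - f x| <= 2^-1 * `|y - x|.
  by move=> xr yr; apply: quasi_newton_contraction; exact: gP.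
have uu : `|u - u| <= r by rewrite subrr normr0.
have [||||x y ux uy|x /= xr fx] :=
    @contraction_fixed_point R E [set x | `|x - u| <= r] f 2^-1.
- by rewrite invr_ge0 ler0n /= invf_lt1// ltr1n.
- rewrite (_ : [set x | _] = closed_ball_ Num.norm u r).
    exact: closed_closed_ball_.
  by apply/seteqP; split=> x /=; rewrite distrC.
- by exists u.
- move=> x /= xr; rewrite -(subrKA (f u)) (le_trans (ler_normD _ _))//.
  rewrite (le_trans (lerD (fP _ _ uu xr) fu))//.
  by rewrite (le_trans (lerD (ler_wpM2l _ xr) (lexx _)))//; lra.
- exact: fP.
have gx : g x = 0.
  apply/eqP; rewrite -N_eq0; apply/eqP.
  by move/(congr1 (fun z => x - z)): fx; rewrite /f subKr subrr.
exists x; split=> //.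
  have : `|x - u| <= 2^-1 * `|x - u| + r / 4.
    rewrite -{1}fx -(subrKA (f u)) (le_trans (ler_normD _ _))//.
    by rewrite lerD// fP.
  lra.
move=> y yr gy; have := fP x y xr yr; rewrite /f gx gy.
have /eqP -> : N 0 == 0 by rewrite N_eq0.
rewrite !subr0 => xy; apply/eqP; rewrite -subr_eq0 -normr_le0.
by have := normr_ge0 (y - x); lra.
Qed.

(** Surjectivity: [M h - w] has a zero in a large enough ball. Lower bound:
    [|h| <= C * |M0 h| <= C * |M h| + |h| / 2]. *)
Lemma near_isomorphism (M : clin E W) : `|M - M0| <= e ->
  (forall w, exists h, M h = w) /\ forall h, `|h| <= 2 * C * `|M h|.
Proof.
move=> MM0; split=> [w|h].
  (* This radius makes the condition on the initial error an equality. *)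
  pose r := 4 * (C * `|M 0 - w|).
  have [|y x _ _||x [/eqP]] := @quasi_newton_zero (fun h => M h - w) 0 r.
  - by rewrite !mulr_ge0// ltW.
  - rewrite opprB subrKA -clinB -clinBE.
    by rewrite (le_trans (clin_ler _ _))// ler_wpM2r.
  - by rewrite /r mulrAC mulfV ?mul1r.
  - by rewrite subr_eq0 => /eqP Mx _ _; exists x.
have : `|M0 h| <= `|M h| + e * `|h|.
  rewrite -[M0 h](subrK (M h)) addrC (le_trans (ler_normD _ _))// lerD//.
  by rewrite distrC -clinBE (le_trans (clin_ler _ _))// ler_wpM2r.
move=> /(ler_wpM2l (ltW C0)) /(le_trans (M0_ge h)).
rewrite mulrDr (mulrA C e) /e invfM mulrCA mulfV ?mulr1 ?gt_eqF//.
by rewrite -mulrA; lra.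
Qed.

End QuasiNewton.

Section ImplicitFunction.
Context {R : realType} (E W : completeNormedModType R).
Variables (s1 : R) (A : R * E -> W) (dA : R * E -> clin (R * E)%type W) (u : E).

Let D : set (R * E) := `[0, s1] `*` [set: E].

Hypotheses (s1_gt0 : 0 < s1) (Au0 : A (0, u) = 0).
Hypothesis dAP : forall x, D x -> is_diff_in D A x (dA x).
Hypothesis dA_cont : {within D, continuous dA}.

Let M0 := partial2 (dA (0, u)).
Hypothesis M0_bij : bijective M0.

Let DP s h : D (s, h) <-> 0 <= s <= s1.
Proof.
rewrite /D /setX /=; split=> [[]|s01]; first by rewrite in_itv.
by rewrite in_itv.
Qed.

Lemma convex_strip : convex_in D.
Proof.
move=> [a x] [b y] /DP/andP[a0 a1] /DP/andP[b0 b1] t /andP[t0 t1].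
apply/DP => /=.
have -> : a + t * (b - a) = (1 - t) * a + t * b by ring.
have t1' : 0 <= 1 - t by rewrite subr_ge0.
rewrite addr_ge0 ?mulr_ge0//=.
rewrite (_ : s1 = (1 - t) * s1 + t * s1); last by ring.
by rewrite lerD// ler_wpM2l.
Qed.

Let pair_lt s h (d : R) : 0 <= s < d -> `|h - u| < d -> `|(s, h) - (0, u)| < d.
Proof.
by move=> /andP[s0 sd] hd; rewrite prod_normE /= gt_max subr0 ger0_norm// sd.
Qed.

Lemma implicit_function : exists (s0 : R) (us : R -> E),
  [/\ 0 < s0 <= s1, solution_path A u s0 us,
    forall vs, solution_path A u s0 vs -> forall s, 0 <= s <= s0 -> vs s = us s
  & exists2 v, is_diff_in `[0, s0] us 0 (line v) & M0 v = - dA (0, u) (1, 0)].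
Proof.
have [N _ NK] := M0_bij.
(* By injectivity the bounded preimage from the open mapping theorem is [h] itself. *)
have [C C0 M0_ge] : exists2 C : R, 0 < C & forall h, `|h| <= C * `|M0 h|.
  have [|C C0 CP] := @open_mapping R E W M0; first by move=> w; exists (N w).
  exists C => // h; have [x Mx xC] := CP (M0 h).
  by rewrite -[h in leLHS](bij_inj M0_bij Mx).
pose e : R := (2 * C)^-1.
have e0 : 0 < e by rewrite invr_gt0 mulr_gt0.
have D0 : D (0, u) by apply/DP; rewrite lexx ltW.
have [d d0 [dA_near A_near]] :=
  strict_differentiability convex_strip dAP dA_cont D0 e0.
pose r := d / 2.
have r0 : 0 < r by rewrite divr_gt0.
have rd : r < d by rewrite /r ltr_pdivrMr// ltr_pMr// ltr1n.
pose L := `|dA (0, u)| + e.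
have L0 : 0 < L by rewrite ltr_wpDl.
have CL0 : 0 < C * L by rewrite mulr_gt0.
have A_lip x y : D x -> D y -> `|x - (0, u)| < d -> `|y - (0, u)| < d ->
    `|A y - A x| <= L * `|y - x|.
  move=> Dx Dy xd yd; have Axy := A_near x y Dx Dy xd yd.
  rewrite -[A y - A x](subrK (dA (0, u) (y - x))) /L mulrDl [leRHS]addrC.
  by rewrite (le_trans (ler_normD _ _))// lerD// clin_ler.
(* The three bounds keep [s] in the domain, keep [(s, h)] in the neighbourhood of radius [d], and
   give [C * |A (s, u)| <= r / 4], the initial error allowed. *)
pose s0 := Num.min s1 (Num.min r (r / 4 / (C * L))).
have s0_gt0 : 0 < s0 by rewrite !lt_min s1_gt0 r0 !divr_gt0.
have s0s1 : s0 <= s1 by rewrite ge_min lexx.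
have s0r : s0 <= r by rewrite !ge_min lexx orbT.
have s0L : C * (L * s0) <= r / 4.
  by rewrite mulrA mulrC -ler_pdivlMr// !ge_min lexx !orbT.
have inD s h : 0 <= s <= s0 -> D (s, h).
  by move=> /andP[s_ge0 ss0]; apply/DP; rewrite s_ge0 (le_trans ss0).
have ind s h : 0 <= s <= s0 -> `|h - u| <= r -> `|(s, h) - (0, u)| < d.
  move=> /andP[s_ge0 ss0] hr; apply: pair_lt; last exact: le_lt_trans rd.
  by rewrite s_ge0 (le_lt_trans ss0)// (le_lt_trans s0r).
have ur : `|u - u| <= r by rewrite subrr normr0 ltW.
have A_near2 s x y : 0 <= s <= s0 -> `|x - u| <= r -> `|y - u| <= r ->
    `|A (s, y) - A (s, x) - M0 (y - x)| <= e * `|y - x|.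
  move=> ss0 xr yr.
  have := A_near (s, x) (s, y) (inD _ _ ss0) (inD _ _ ss0)
    (ind _ _ ss0 xr) (ind _ _ ss0 yr).
  have -> : (s, y) - (s, x) = (0, y - x) by congr (_, _); exact: subrr.
  by rewrite prod_normE /= normr0 (max_r (normr_ge0 _)).
(* The condition on [s] sits under the existential so that [choice] yields a total function,
   arbitrary outside [0, s0]. *)
have ex_us s : exists x, 0 <= s <= s0 -> [/\ A (s, x) = 0, `|x - u| <= r / 2 &
    forall y, `|y - u| <= r -> A (s, y) = 0 -> y = x].
  have [ss0|] := boolP (0 <= s <= s0); last by exists 0.
  have [|x xP] := quasi_newton_zero C0 NK M0_ge (ltW r0)
    (fun x y => @A_near2 s x y ss0); last by exists x.
  apply: le_trans s0L; rewrite ler_wpM2l ?(ltW C0)//.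
  rewrite -[A (s, u)]subr0 -Au0.
  have z0 : 0 <= (0 : R) <= s0 by rewrite lexx ltW.
  rewrite (le_trans (A_lip _ _ (inD _ _ z0) (inD _ _ ss0) (ind _ _ z0 ur)
    (ind _ _ ss0 ur)))// ler_wpM2l ?(ltW L0)//.
  move: ss0 => /andP[s_ge0 ss0].
  by rewrite prod_normE /= subrr subr0 normr0 ger0_norm// max_l.
have [us usP] := choice ex_us.
have us_r s : 0 <= s <= s0 -> `|us s - u| <= r.
  move=> /usP[_ /le_trans + _]; apply.
  by rewrite ler_pdivrMr// ler_peMr ?(ltW r0)// ler1n.
pose z s := (s, us s).
pose K := 1 + 2 * C * L.
have K1 : 1 <= K by rewrite lerDl !mulr_ge0// ltW.
have K0 : 0 < K by rewrite (lt_le_trans ltr01).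
(* Both states are compared through [A (t, us s)]; since [C * e = 1/2], the term in [us t - us s] is
   absorbed on the left. *)
have us_lip s t : 0 <= s <= s0 -> 0 <= t <= s0 ->
    `|us t - us s| <= 2 * C * L * `|t - s|.
  move=> ss0 ts0.
  have := A_near2 t _ _ ts0 (us_r _ ss0) (us_r _ ts0).
  have [-> _ _] := usP _ ts0; rewrite sub0r -opprD normrN => near.
  have := A_lip (s, us s) (t, us s) (inD _ _ ss0) (inD _ _ ts0)
    (ind _ _ ss0 (us_r _ ss0)) (ind _ _ ts0 (us_r _ ss0)).
  have [-> _ _] := usP _ ss0; rewrite subr0.
  have -> : (t, us s) - (s, us s) = (t - s, 0) by congr (_, _); exact: subrr.
  rewrite prod_normE /= normr0 (max_l (normr_ge0 _)) => lipA.
  have : `|M0 (us t - us s)| <= e * `|us t - us s| + L * `|t - s|.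
    rewrite -[M0 _](addKr (A (t, us s))) addrC (le_trans (ler_normB _ _))//.
    by rewrite lerD.
  move=> /(ler_wpM2l (ltW C0)) /(le_trans (M0_ge _)).
  rewrite mulrDr (mulrA C e) /e invfM mulrCA mulfV ?mulr1 ?gt_eqF//.
  by rewrite -!mulrA; lra.
have z_lip s t : 0 <= s <= s0 -> 0 <= t <= s0 -> `|z t - z s| <= K * `|t - s|.
  move=> ss0 ts0; rewrite prod_normE /= ge_max ler_peMl//=.
  rewrite (le_trans (us_lip _ _ ss0 ts0))// ler_wpM2r// /K lerDr//.
pose M s := partial2 (dA (z s)).
have M_iso s : 0 <= s <= s0 -> (forall w, exists h, M s h = w) /\
    forall h, `|h| <= 2 * C * `|M s h|.
  move=> ss0; apply: (near_isomorphism C0 NK M0_ge).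
  rewrite /M /M0 partial2B (le_trans (partial2_le _))//.
  by apply: dA_near; [exact: inD|apply: ind => //; exact: us_r].
have ex_v s : exists v, 0 <= s <= s0 -> M s v = - dA (z s) (1, 0).
  have [ss0|] := boolP (0 <= s <= s0); last by exists 0.
  by have [/(_ (- dA (z s) (1, 0)))[v vP] _] := M_iso s ss0; exists v.
have [v vP] := choice ex_v.
(* [0 = A (z t) - A (z s)] is [M s] applied to the Taylor remainder of [us], up
   to [o(t - s)]. *)
have us_diff s : 0 <= s <= s0 -> is_diff_in `[0, s0] us s (line (v s)).
  move=> ss0; apply/is_diff_inP => h h0.
  (* [2 * C] is lost in inverting [M s] and [K] in bounding [z t - z s] by [t - s]. *)
  have h'0 : 0 < h / (2 * C * K) by rewrite divr_gt0// !mulr_gt0.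
  have [d' d'0 d'P] := (is_diff_inP _ _ _ _).1 (dAP (inD s (us s) ss0)) _ h'0.
  exists (d' / K) => [|t]; first by rewrite divr_gt0.
  rewrite /= in_itv /= => ts0 ts.
  have zd : `|z t - z s| < d'.
    by rewrite (le_lt_trans (z_lip _ _ ss0 ts0))// mulrC -ltr_pdivlMr.
  have := d'P (z t) (inD _ _ ts0) zd.
  rewrite /z; have [-> _ _] := usP _ ts0; have [-> _ _] := usP _ ss0.
  rewrite subr0 sub0r normrN.
  have -> : (t, us t) - (s, us s) = (t - s, us t - us s) by [].
  rewrite partialE -[partial2 _]/(M s).
  rewrite -[dA _ _]opprK -/(z s) -(vP s ss0) scalerN -clinZ addrC -clinB => Mle.
  have [_ /(_ (us t - us s - (t - s) *: v s))/le_trans] := M_iso s ss0; apply.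
  rewrite (le_trans (ler_wpM2l _ Mle)) ?mulr_ge0 ?(ltW C0)//.
  have -> : (t - s, us t - us s) = z t - z s by [].
  rewrite (le_trans (ler_wpM2l _ (ler_wpM2l (ltW h'0) (z_lip _ _ ss0 ts0))))//.
    by rewrite mulr_ge0// ltW.
  rewrite le_eqVlt; apply/orP; left; apply/eqP.
  by field; rewrite !gt_eqF.
(* [M t (v t - v s)] is the increment of [dA] along the curve at [(1, v s)]. *)
have v_cont : {within `[0, s0], continuous (fun s => line (v s))}.
  apply/within_continuousP => s; rewrite /= in_itv /= => ss0 h h0.
  have q0 : 0 < 2 * C * (`|(1, v s) : R * E| + 1).
    by rewrite !mulr_gt0// ltr_wpDl.
  have h'0 : 0 < h / (2 * C * (`|(1, v s) : R * E| + 1)) by rewrite divr_gt0.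
  have [d' d'0 d'P] := (within_continuousP _ _).1 dA_cont _ (inD s (us s) ss0) _ h'0.
  exists (d' / K) => [|t]; first by rewrite divr_gt0.
  rewrite /= in_itv /= => ts0 ts.
  have zd : `|z t - z s| < d'.
    by rewrite (le_lt_trans (z_lip _ _ ss0 ts0))// mulrC -ltr_pdivlMr.
  have dAts := d'P (z t) (inD _ _ ts0) zd.
  rewrite (le_trans (lineB_le _ _))//.
  have [_ /(_ (v t - v s))/le_trans] := M_iso t ts0; apply.
  have -> : M t (v t - v s) = - ((dA (z t) - dA (z s)) (1, v s)).
    rewrite clinB (vP t ts0) clinBE (partialE (dA (z t)) 1 (v s)).
    rewrite (partialE (dA (z s)) 1 (v s)) !scale1r.
    rewrite -[partial2 (dA (z s)) _]/(M s (v s)) (vP s ss0) subrr subr0.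
    by rewrite opprD.
  rewrite normrN (le_trans (ler_wpM2l _ (clin_ler _ _))) ?mulr_ge0 ?(ltW C0)//.
  rewrite mulrCA.
  rewrite (le_trans (ler_wpM2r _ dAts))// ?mulr_ge0 ?(ltW C0)//.
  rewrite mulrAC ler_pdivrMr// ler_wpM2l ?(ltW h0)// ler_wpM2l ?mulr_ge0 ?(ltW C0)//.
  by rewrite lerDl.
have us0 : us 0 = u.
  have [|_ _ /(_ u ur)] := usP 0; first by rewrite lexx ltW.
  by move=> /(_ Au0).
exists s0, us; split; first by rewrite s0_gt0.
- split=> //; last by move=> s /usP[].
  by exists (fun s => line (v s)) => // s; rewrite /= in_itv; exact: us_diff.
- move=> vs [[dvs vsP _] vs0 Avs].
  have vs_r s : 0 <= s <= s0 -> `|vs s - u| <= r.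
    move=> /andP[s_ge0 ss0]; rewrite leNgt; apply/negP => r_lt.
    (* Near [t], the differential bounds the increments of [vs] by [1 + |dvs t|] times those of
       time. *)
    have nvs : {within `[0, s], continuous (fun t => `|vs t - u|)}.
      apply/within_continuousP => t; rewrite /= in_itv /= => /andP[t0 ts] h h0.
      have ts0 : [set` `[0, s0]] t by rewrite /= in_itv /= t0 (le_trans ts).
      have [d' d'0 d'P] := (is_diff_inP _ _ _ _).1 (vsP t ts0) 1 ltr01.
      have q0 : 0 < 1 + `|dvs t| by rewrite ltr_pwDl.
      exists (Num.min d' (h / (1 + `|dvs t|))).
        by rewrite lt_min d'0 divr_gt0.
      move=> t'; rewrite /= in_itv /= => /andP[t'0 t's] t't.
      rewrite lt_min in t't; move: t't => /andP[t'd t'h].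
      have t's0 : [set` `[0, s0]] t' by rewrite /= in_itv /= t'0 (le_trans t's).
      have := d'P t' t's0 t'd; rewrite mul1r => dvs_le.
      rewrite (le_trans (ler_dist_dist _ _))// opprB subrKA.
      rewrite -[vs t' - vs t](subrK (dvs t (t' - t))).
      rewrite (le_trans (ler_normD _ _))// (le_trans (lerD dvs_le (clin_ler _ _)))//.
      by rewrite -[X in X + _]mul1r -mulrDl mulrC -ler_pdivlMr// ltW.
    (* [|vs t - u|] would take a value between [r / 2] and [r]. *)
    have [|c cs cr] := @IVT _ _ 0 s (3 / 4 * r) s_ge0 nvs.
      rewrite vs0 subrr normr0 ge_min le_max.
      rewrite mulr_ge0 ?(ltW r0)//=; apply/orP; right.
      by rewrite (le_trans _ (ltW r_lt))//; lra.
    move: cs; rewrite in_itv /= => /andP[c0 cs].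
    have cs0 : 0 <= c <= s0 by rewrite c0 (le_trans cs).
    have [_ + uniq_c] := usP c cs0.
    have <- : vs c = us c by apply: uniq_c; [rewrite cr; lra|exact: Avs].
    by rewrite cr; lra.
  move=> s ss0; have [_ _] := usP s ss0; apply; [exact: vs_r|exact: Avs].
- have z0 : 0 <= (0 : R) <= s0 by rewrite lexx ltW.
  exists (v 0); first exact: us_diff.
  by have := vP 0 z0; rewrite /M /z us0.
Qed.

End ImplicitFunction.

(** * Right derivatives and the adjoint state *)

Section Curves.
Context {R : realType}.

(** On the whole space the relative notion is the little-o expansion that determines the library
    differential. *)
Lemma cdiff_is_diff_in (V W : normedModType R) (f : V -> W) x (l : clin V W) :
  is_diff_in setT f x l -> cdiff f x = l.
Proof.
move=> /is_diff_inP fl.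
have fo : f \o shift x = cst (f x) + l +o_ 0 id.
  apply/eqaddoP => e e0; have [d d0 dP] := fl e e0.
  apply/nbhs_norm0P; exists d => // h /= hd.
  have := dP (h + x) I; rewrite addrK => /(_ hd); rewrite -addrA -opprD.
  exact.
have dfl : 'd f x = l :> (V -> W).
  exact: diff_unique (@clin_continuous _ _ _ l) fo.
have df : differentiable f x.
  by apply/diff_locallyP; rewrite dfl; split=> //; exact: clin_continuous.
by apply: clinP => h; rewrite cdiffE// dfl.
Qed.

(* The quotients are taken along a curve that need only have a one-sided
   derivative at [0], which is all a differential relative to [D] sees. *)
Lemma cvg_rquot_comp (V W : normedModType R) (D : set V) (f : V -> W)
    (l : clin V W) (c : R -> V) (v : V) (s0 : R) :
  0 < s0 -> (forall s, 0 <= s <= s0 -> D (c s)) -> is_diff_in D f (c 0) l ->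
  rquot c 0 h @[h --> 0^'+] --> v ->
  rquot (f \o c) 0 h @[h --> 0^'+] --> l v.
Proof.
move=> s0_gt0 Dc /is_diff_inP fl cv; apply/cvgrPdist_le => e e0.
have q0 : 0 < `|v| + 1 by rewrite ltr_wpDl.
(* Near 0 the quotients of [c] are bounded by [|v| + 1], so the remainder of [f] contributes at most
   [e / 2]. *)
have k0 : 0 < e / 2 / (`|v| + 1) by rewrite !divr_gt0.
have [d d0 dP] := fl _ k0.
have lcv : l (rquot c 0 h) @[h --> 0^'+] --> l v.
  by apply: cvg_comp cv _; exact: clin_continuous.
have e2 : 0 < e / 2 by rewrite divr_gt0.
have /cvgrPdist_le/(_ _ e2) l_near := lcv.
have /cvgrPdist_le/(_ _ ltr01) c_near := cv.
near=> h.
have h0 : 0 < h by near: h; exact: nbhs_right_gt.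
have hs0 : h <= s0 by apply: ltW; near: h; exact: nbhs_right_lt.
have hd : h < d / (`|v| + 1) by near: h; apply: nbhs_right_lt; rewrite divr_gt0.
have vq : `|v - rquot c 0 h| <= 1 by near: h.
have qle : `|rquot c 0 h| <= `|v| + 1.
  rewrite -[rquot c 0 h](subKr v) (le_trans (ler_normB _ _))// lerD//.
have cE : c h - c 0 = h *: rquot c 0 h.
  by rewrite /rquot add0r scalerA mulfV ?gt_eqF// scale1r.
have nc : `|c h - c 0| = h * `|rquot c 0 h| by rewrite cE normrZ gtr0_norm.
have -> : l v - rquot (f \o c) 0 h = (l v - l (rquot c 0 h)) -
    h^-1 *: (f (c h) - f (c 0) - l (c h - c 0)).
  rewrite cE (clinZ l h) scalerBr scalerA mulVf ?gt_eqF// scale1r opprB addrA subrK.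
  by rewrite /rquot add0r.
rewrite (splitr e) (le_trans (ler_normB _ _))// lerD//; first by near: h.
rewrite normrZ gtr0_norm ?invr_gt0// ler_pdivrMl//.
have := dP (c h) (Dc h _); rewrite (ltW h0) hs0 => /(_ erefl).
rewrite nc => /(_ _)/le_trans; apply.
  by rewrite (le_lt_trans (ler_wpM2l (ltW h0) qle))// -ltr_pdivlMr.
rewrite mulrCA ler_wpM2l ?(ltW h0)// mulrAC ler_pdivrMr//.
by rewrite ler_wpM2l// ltW.
Unshelve. all: by end_near. Qed.

Lemma cvg_rquot_cst (V : normedModType R) (v : V) :
  rquot (cst v) 0 h @[h --> (0:R)^'+] --> (0 : V).
Proof.
rewrite (_ : rquot (cst v) 0 = cst 0); first exact: cvg_cst.
by apply/funext => h; rewrite /rquot subrr scaler0.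
Qed.

Lemma cvg_rquot_id : rquot (id : R -> R) 0 h @[h --> (0:R)^'+] --> (1 : R).
Proof.
apply: cvg_near_cst; near=> h.
have h0 : 0 < h by near: h; exact: nbhs_right_gt.
by rewrite /rquot add0r subr0 [_ *: _]mulVf// gt_eqF.
Unshelve. all: by end_near. Qed.

Lemma cvg_rquot_pair (V : normedModType R) (c : R -> V) (v : V) :
  rquot c 0 h @[h --> (0:R)^'+] --> v ->
  rquot (fun s => (s, c s)) 0 h @[h --> (0:R)^'+] --> ((1, v) : R * V).
Proof.
move=> cv; have := cvg_pair cvg_rquot_id cv.
by apply.
Qed.

End Curves.

Section InverseOfIsomorphism.
Context {R : realType} (E W : completeNormedModType R).

Lemma clin_inverse (M : clin E W) : bijective M ->
  exists N : clin W E, (forall w, M (N w) = w) /\ (forall h, N (M h) = h).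
Proof.
move=> Mbij; have [N MK NK] := Mbij.
have [|C C0 CP] := @open_mapping R E W M; first by move=> w; exists (N w).
have Ncl : N \in @clinear R W E.
  apply: (@bounded_clinear _ _ _ _ C) => [a x y|w].
    by apply: (bij_inj Mbij); rewrite NK clinD clinZ !NK.
  by have [x Mx xC] := CP w; rewrite -{1}Mx MK.
by exists (Clin Ncl).
Qed.

End InverseOfIsomorphism.

(** With [N] the bounded inverse of [M], the equation for [q] says [g q = b (N g)] for all [g]: [q]
    represents the bidual element [b] composed with [N]. Reflexivity provides [q], and injectivity
    of [bidual] its uniqueness. *)
Lemma adjoint_bijective (R : realType) (E F : completeNormedModType R)
    (M : clin E (clin F R)) (b : clin E R) :
  reflexive_space F -> bijective M ->
  exists p, unique (fun q : F => adjoint M q = b) p.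
Proof.
move=> reflF Mbij; have [N [NK MK]] := clin_inverse Mbij.
have bNcl : (fun g => b (N g)) \in @clinear R (clin F R) R.
  apply: (@bounded_clinear _ _ _ _ (`|b| * `|N|)) => [a x y|g].
    by rewrite clinD clinZ clinD clinZ.
  by rewrite (le_trans (clin_ler _ _))// -mulrA ler_wpM2l// clin_ler.
have [p pE] := reflF (Clin bNcl).
have pP (g : clin F R) : g p = b (N g) :=
  congr1 (fun xi : clin (clin F R) R => xi g) pE.
exists p; split=> [|q qE]; first by apply: clinP => h; rewrite /= pP MK.
apply: bidual_inj; apply: clinP => g /=; rewrite pP.
by have <- := congr1 (fun f : clin E R => f (N g)) qE; rewrite /= NK.
Qed.

(** * State derivative and shape derivative *)

Theorem theorem1 (R : realType) (d : nat) (D Omega : set 'rV[R]_d)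
    (openD : open D) (boundedD : bounded_set D)
    (openOmega : open Omega) (OmegaD : compactly_contained Omega D)
    (E F : completeNormedModType R) (reflF : reflexive_space F)
    (s1 : R) (s1_gt0 : 0 < s1)
    (G : R -> E -> F -> R) (A : R * E -> clin F R) (B : R * E -> R)
    (GE : forall s phi psi, 0 <= s <= s1 ->
      G s phi psi = A (s, phi) psi + B (s, phi))
    (C1A : C1_in (`[0, s1] `*` [set: E]) A)
    (u : E) (Au0 : A (0, u) = 0)
    (diffB : differentiable_in (`[0, s1] `*` [set: E]) B (0, u)) :
  let Au : clin E (clin F R) := cdiff (fun phi => A (0, phi)) u in
  let Lu : clin F R := rderive (fun s => A (s, u)) 0 in
  let Bu : clin E R := cdiff (fun phi => B (0, phi)) u in
  bijective Au ->
  exists (s0 : R) (us : R -> E),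
    [/\ 0 < s0 <= s1,
        solution_path A u s0 us
        /\ (forall vs : R -> E, solution_path A u s0 vs ->
              forall s, 0 <= s <= s0 -> vs s = us s),
        rderivable us 0
        /\ unique (fun v : E => Au v = - Lu) (rderive us 0)
      & forall (theta : 'rV[R]_d -> 'rV[R]_d) (T : R -> 'rV[R]_d -> 'rV[R]_d)
          (J : set 'rV[R]_d -> R),
          lipschitz_field D theta -> is_flow D s1 theta T ->
          (forall s psi, 0 <= s <= s0 -> J (T s @` Omega) = G s (us s) psi) ->
          exists p : F,
            [/\ unique (fun q : F => adjoint Au q = - Bu) p,
                shape_derivable J T Omega,
                rderivable (fun s => G s u p) 0,
                shape_derive J T Omega = rderive (fun s => G s u p) 0
              & rderive (fun s => G s u p) 0 =
                  Lu p + rderive (fun s => B (s, u)) 0]].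
Proof.
move=> Au Lu Bu Au_bij.
have [dA dAP dA_cont] := C1A.
have [dB dBP] := diffB.
have D0 h : (`[0, s1] `*` [set: E]) ((0 : R), h).
  by split=> //=; rewrite in_itv /= lexx ltW.
(* The slice [s = 0] of the strip is all of [E], so the relative differential restricts to an
   ordinary one there. *)
have partialP (W : normedModType R) (f : R * E -> W) (l : clin (R * E)%type W) :
    is_diff_in (`[0, s1] `*` [set: E]) f (0, u) l ->
    cdiff (fun phi => f (0, phi)) u = partial2 l.
  move=> /is_diff_inP fl; apply/cdiff_is_diff_in/is_diff_inP => e /fl[r r0 rP].
  have zE (y : E) : (0 : R, y) - (0, u) = (0, y - u) by congr (_, _); exact: subrr.
  have nE (y : E) : `|(0 : R, y) - (0, u)| = `|y - u|.
    by rewrite zE prod_normE /= normr0 max_r.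
  exists r => // y _ yu; have := rP (0, y) (D0 y).
  by rewrite nE zE => /(_ yu).
have u_curve : rquot (fun s => (s, u)) 0 h @[h --> (0 : R)^'+] --> ((1, 0) : R * E).
  exact: cvg_rquot_pair (cvg_rquot_cst u).
have inD (c : R -> E) s : 0 <= s <= s1 -> (`[0, s1] `*` [set: E]) (s, c s).
  by split=> //=; rewrite in_itv.
have dA0 := dAP _ (D0 u).
have Lu_cvg : rquot (fun s => A (s, u)) 0 h @[h --> 0^'+] --> dA (0, u) (1, 0).
  exact: cvg_rquot_comp s1_gt0 (inD (cst u)) dA0 u_curve.
have LuE : Lu = dA (0, u) (1, 0) by exact: cvg_lim Lu_cvg.
have AuE : Au = partial2 (dA (0, u)) by exact: partialP.
have BuE : Bu = partial2 dB by exact: partialP.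
have dsB_cvg : rquot (fun s => B (s, u)) 0 h @[h --> 0^'+] --> dB (1, 0).
  exact: cvg_rquot_comp s1_gt0 (inD (cst u)) dBP u_curve.
have dsBE : rderive (fun s => B (s, u)) 0 = dB (1, 0) by exact: cvg_lim dsB_cvg.
have M_bij : bijective (partial2 (dA (0, u))) by rewrite -AuE.
have [s0 [us [s0s1 us_sol us_uniq [v us_diff Mv]]]] :=
  implicit_function s1_gt0 Au0 dAP dA_cont M_bij.
have [s0_gt0 s01] := andP s0s1.
have [_ us0 usA] := us_sol.
(* The chain rule along the identity curve turns the differential relative to [0, s0] into a right
   derivative. *)
have us_cvg : rquot us 0 h @[h --> 0^'+] --> v.
  rewrite -[v]scale1r -[1 *: v]/(line v 1).
  have ids s : 0 <= s <= s0 -> [set` `[0, s0]] (id s) by rewrite /= in_itv.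
  exact: cvg_rquot_comp s0_gt0 ids us_diff (@cvg_rquot_id R).
have us'E : rderive us 0 = v by exact: cvg_lim us_cvg.
have Auv : Au v = - Lu by rewrite AuE LuE.
exists s0, us; split=> //.
- split; first by apply/cvg_ex; exists v.
  rewrite us'E; split=> // w Auw; apply: (bij_inj Au_bij).
  by rewrite Auv Auw.
move=> theta T J _ flowT JG.
have [p pP] := adjoint_bijective (- Bu) reflF Au_bij.
have z1 : 0 <= (0 : R) <= s1 by rewrite lexx ltW.
have z0 : 0 <= (0 : R) <= s0 by rewrite lexx ltW.
have G_cvg : rquot (fun s => G s u p) 0 h @[h --> 0^'+] --> Lu p + dB (1, 0).
  (* Evaluation at [p] is continuous and linear, so it commutes with the limit of the quotients. *)
  have Ap : bidual p (rquot (fun s => A (s, u)) 0 h) @[h --> 0^'+] --> Lu p.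
    rewrite LuE -[dA _ _ p]/(bidual p (dA (0, u) (1, 0))).
    by apply: cvg_comp Lu_cvg _; exact: clin_continuous.
  apply: cvg_trans (cvgD Ap dsB_cvg); apply: near_eq_cvg; near=> h.
  have h1 : 0 <= h <= s1.
    by apply/andP; split; apply: ltW; near: h;
      [exact: nbhs_right_gt|exact: nbhs_right_lt].
  rewrite /= /rquot add0r !GE// fctE /= add0r.
  rewrite -[LHS]/(h^-1 *: (A (h, u) p - A (0, u) p) + h^-1 *: (B (h, u) - B (0, u))).
  rewrite -scalerDr.
  by congr (_ *: _); rewrite opprD addrACA.
(* Identifies [J Omega] with the time 0 value of [J] along the flow, to which [JG] applies. *)
have T0 : T 0 @` Omega = Omega.
  have OD x : Omega x -> D x.
    by move=> Ox; apply: OmegaD.2; exact: subset_closure.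
  apply/seteqP; split=> [_ [x Ox <-]|x Ox].
    by have [-> _] := flowT x (OD x Ox).
  by exists x => //; have [-> _] := flowT x (OD x Ox).
have JE s : 0 <= s <= s0 -> J (T s @` Omega) = B (s, us s).
  move=> ss0; rewrite (JG s p ss0) GE ?usA ?clin0E ?add0r//.
  by move: ss0 => /andP[-> /le_trans ->].
have J_cvg : shape_quot J T Omega s @[s --> 0^'+] --> Lu p + dB (1, 0).
  (* The adjoint equation tested with the state derivative [v] gives [Lu p = Bu v]. *)
  have -> : Lu p + dB (1, 0) = dB (1, v).
    rewrite (partialE dB 1 v) scale1r -BuE addrC; congr (_ + _).
    have := congr1 (fun f : clin E R => f v) pP.1.
    rewrite /= Auv => /eqP; rewrite eqr_opp => /eqP ->.
    by [].
  have dB' : is_diff_in (`[0, s1] `*` [set: E]) B ((fun s => (s, us s)) 0) dB.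
    by rewrite us0.
  have inD0 s : 0 <= s <= s0 -> (`[0, s1] `*` [set: E]) (s, us s).
    by move=> /andP[s_ge0 ss0]; apply: inD; rewrite s_ge0 (le_trans ss0).
  apply: cvg_trans (cvg_rquot_comp s0_gt0 inD0 dB' (cvg_rquot_pair us_cvg)).
  apply: near_eq_cvg; near=> h.
  have h0 : 0 <= h <= s0.
    by apply/andP; split; apply: ltW; near: h;
      [exact: nbhs_right_gt|exact: nbhs_right_lt].
  rewrite /rquot /shape_quot add0r JE// -[in J Omega]T0 JE//=.
  by rewrite [RHS]mulrC.
have GE' : rderive (fun s => G s u p) 0 = Lu p + dB (1, 0).
  exact: cvg_lim G_cvg.
exists p; split=> //.
- by apply/cvg_ex; exists (Lu p + dB (1, 0)).
- by apply/cvg_ex; exists (Lu p + dB (1, 0)).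
- by rewrite GE'; exact: cvg_lim J_cvg.
- by rewrite GE' dsBE.
Unshelve. all: by end_near. Qed.
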